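(* Let $p$ be a prime, let $R$ be a finite ring such that $p$ is the smallest prime dividing $|R|$, and let $S$ be a subring of $R$. Then \[ \frac{|Z(S,R)|}{|S|}+\frac{p(|S|-|Z(S,R)|)}{|S||R|}\le \Pr(S,R)\le \frac{(p-1)|Z(S,R)|+|S|}{p|S|}. \]
   Context: Rings are associative and are not required to have an identity; a subring is an additive subgroup closed under multiplication. For a subring $S$ of a finite ring $R$: $Z(S,R)=\{s\in S: sr=rs \text{ for all } r\in R\}$ and $\Pr(S,R)=\dfrac{|\{(s,r)\in S\times R: sr=rs\}|}{|S|\,|R|}$. *)

(* Defs.v *)
From HB Require Import structures.
From mathcomp Require Import all_boot all_order all_algebra.

Set Implicit Arguments.
Unset Strict Implicit.
Unset Printing Implicit Defensive.

Import GRing.Theory.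
Local Open Scope ring_scope.

(* The ring structures of ssralg all have a unit, so rings that need not have
   an identity are set up here on top of zmodType.  [%g] is not reused for the
   product: on a finZmodType, (x * y)%g already stands for x + y. *)
HB.mixin Record Zmodule_isRng R of GRing.Zmodule R := {
  rngmul : R -> R -> R;
  rngmulA : associative rngmul;
  rngmulDl : left_distributive rngmul +%R;
  rngmulDr : right_distributive rngmul +%R
}.

#[short(type="rngType")]
HB.structure Definition Rng := {R of GRing.Zmodule R & Zmodule_isRng R}.

#[short(type="finRngType")]
HB.structure Definition FinRng := {R of Rng R & Finite R}.

Declare Scope rng_scope.
Delimit Scope rng_scope with rng.
Notation "x ** y" := (rngmul x y)
  (at level 40, left associativity) : rng_scope.
Open Scope rng_scope.

Definition subrng_closed (R : rngType) (S : {pred R}) : Prop :=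
  zmod_closed S /\ {in S &, forall x y, x ** y \in S}.

Definition rel_center (R : finRngType) (S : {set R}) : {set R} :=
  [set s in S | [forall r : R, s ** r == r ** s]].

Definition rel_commPr (R : finRngType) (S : {set R}) : rat :=
  #|[set u : R * R | (u.1 \in S) && (u.1 ** u.2 == u.2 ** u.1)]|%:R
    / (#|S|%:R * #|R|%:R).

Definition smallest_prime_divisor (p n : nat) : Prop :=
  [/\ prime p, p %| n & forall q : nat, prime q -> q %| n -> p <= q]%N.

(* Main.v *)
Require Import Defs.
From mathcomp Require Import all_boot all_order all_fingroup all_algebra.
From mathcomp Require Import ring.

(** Commuting pairs are counted one left component at a time: the number of
    pairs in [S * R] with [s ** r = r ** s] is the sum over [s] in [S] of the
    orders of the centralizers of [s] in [R].  A central [s] contributes [#|R|].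
    For every other [s] the centralizer is a proper additive subgroup of [R],
    and it is nonzero because it contains [s] itself, which is not [0].  By
    Lagrange, both its order and its index are divisors of [#|R|] greater
    than 1, hence at least [p] ([leq_smallest_prime_divisor]); so the
    contribution of [s] lies between [p] and [#|R| / p]
    ([card_centralizer_noncentral]).  Summing these bounds over the
    [#|S| - #|Z(S,R)|] noncentral elements of [S], and dividing by
    [#|S| * #|R|], gives the two inequalities. *)

Import Order.TTheory GRing.Theory Num.Theory.
Local Open Scope ring_scope.

Lemma rngmul0r {R : rngType} (x : R) : 0 ** x = 0.
Proof. by apply: (addrI (0 ** x)); rewrite -rngmulDl !addr0. Qed.

Lemma rngmulr0 {R : rngType} (x : R) : x ** 0 = 0.
Proof. by apply: (addrI (x ** 0)); rewrite -rngmulDr !addr0. Qed.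

Lemma card_zmod_closed_dvd {V : finZmodType} (A : {set V}) :
  zmod_closed A -> (#|A| %| #|V|)%N.
Proof.
case=> A0 AB.
have gA : group_set A.
  apply/group_setP; split=> // x y Ax Ay.
  by rewrite FinRing.zmodMgE -[y]opprK AB // -[- y]sub0r AB.
by rewrite -cardsT (cardSg (subsetT (Group gA))).
Qed.

Lemma leq_smallest_prime_divisor {p n d : nat} :
  smallest_prime_divisor p n -> (d %| n -> 1 < d -> p <= d)%N.
Proof.
case=> p_pr p_n p_min d_n d_gt1.
have d_gt0 : (0 < d)%N by apply: ltnW.
apply: (@leq_trans (pdiv d)); last exact: pdiv_leq.
by apply: p_min; rewrite ?pdiv_prime // (dvdn_trans (pdiv_dvd d)).
Qed.

Definition rng_centralizer {R : finRngType} (s : R) : {set R} :=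
  [set r | s ** r == r ** s].

Lemma rng_centralizer_zmod_closed {R : finRngType} (s : R) :
  zmod_closed (rng_centralizer s).
Proof.
split=> [|x y]; first by rewrite inE rngmul0r rngmulr0.
rewrite !inE => /eqP sx /eqP sy; apply/eqP/(addIr (s ** y)).
by rewrite -rngmulDr subrK sx sy -rngmulDl subrK.
Qed.

Lemma in_rel_center {R : finRngType} (S : {set R}) (s : R) :
  (s \in rel_center S) = (s \in S) && (rng_centralizer s == setT).
Proof.
rewrite inE; congr (_ && _); apply/forallP/eqP => [sC | sC r].
  by apply/setP=> r; rewrite !inE sC.
by have := in_setT r; rewrite -sC inE.
Qed.

(** Both bounds come from Lagrange: the first applies it to the order of the
    centralizer, nontrivial since [s] commutes with itself, the second to its
    index, nontrivial since [s] is not central. *)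
Lemma card_centralizer_noncentral {p : nat} {R : finRngType} (s : R) :
  smallest_prime_divisor p #|R| -> rng_centralizer s != setT ->
  (p <= #|rng_centralizer s|)%N /\ (p * #|rng_centralizer s| <= #|R|)%N.
Proof.
move=> hp sC.
have [C0 _] := rng_centralizer_zmod_closed s.
have dvC := card_zmod_closed_dvd _ (rng_centralizer_zmod_closed s).
have R_gt0 : (0 < #|R|)%N by apply/card_gt0P; exists 0.
split.
  apply: (leq_smallest_prime_divisor hp) => //.
  rewrite (cardsD1 0) C0 ltnS; apply/card_gt0P; exists s.
  rewrite !inE eqxx andbT; apply: contraNneq sC => ->.
  by apply/eqP/setP=> r; rewrite !inE rngmul0r rngmulr0 eqxx.
have idxE : (#|R| %/ #|rng_centralizer s| * #|rng_centralizer s| = #|R|)%N.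
  exact: divnK.
rewrite -[X in (_ <= X)%N]idxE leq_mul2r; apply/orP; right.
apply: (leq_smallest_prime_divisor hp).
  by rewrite -[X in (_ %| X)%N]idxE dvdn_mulr.
have : (#|rng_centralizer s| < #|R|)%N.
  by rewrite -cardsT proper_card // properT.
rewrite -[X in (_ < X)%N]idxE.
by case: (_ %/ _)%N => [|[|k]] //; rewrite ?mul0n // mul1n ltnn.
Qed.

Lemma card_commuting_pairs {R : finRngType} (S : {set R}) :
  #|[set u : R * R | (u.1 \in S) && (u.1 ** u.2 == u.2 ** u.1)]|
  = (\sum_(s in S) #|rng_centralizer s|)%N.
Proof.
under eq_bigr => s _ do rewrite -sum1_card.
rewrite pair_big_dep /= -sum1_card.
by apply: eq_bigl => u; rewrite !inE.
Qed.

Lemma card_commuting_pairs_center {R : finRngType} (S : {set R}) :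
  #|[set u : R * R | (u.1 \in S) && (u.1 ** u.2 == u.2 ** u.1)]|
  = (#|rel_center S| * #|R|
     + \sum_(s in S :\: rel_center S) #|rng_centralizer s|)%N.
Proof.
rewrite card_commuting_pairs (big_setID (rel_center S)) /=; congr (_ + _)%N.
rewrite -sum_nat_const (setIidPr _); last first.
  by apply/subsetP=> s; rewrite in_rel_center => /andP[].
apply: eq_bigr => s; rewrite in_rel_center => /andP[_ /eqP->].
exact: cardsT.
Qed.

Theorem theorem2p5 (p : nat) (R : finRngType) (S : {set R})
    (hp : smallest_prime_divisor p #|R|) (hS : subrng_closed S) :
  (#|rel_center S|%:R / #|S|%:R
     + p%:R * (#|S|%:R - #|rel_center S|%:R) / (#|S|%:R * #|R|%:R)
     <= rel_commPr S)
  /\ (rel_commPr S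
     <= ((p%:R - 1) * #|rel_center S|%:R + #|S|%:R) / (p%:R * #|S|%:R)).
Proof.
have [[S0 _] _] := hS.
have S_gt0 : 0 < #|S|%:R :> rat by rewrite ltr0n; apply/card_gt0P; exists 0.
have R_gt0 : 0 < #|R|%:R :> rat by rewrite ltr0n; apply/card_gt0P; exists 0.
have p_gt0 : 0 < p%:R :> rat by case: hp => /prime_gt0; rewrite ltr0n.
rewrite /rel_commPr card_commuting_pairs_center.
set D := S :\: rel_center S; set M := (\sum_(s in D) _)%N.
have boundD s : s \in D ->
    (p <= #|rng_centralizer s|)%N /\ (p * #|rng_centralizer s| <= #|R|)%N.
  rewrite in_setD in_rel_center => /andP[+ sS]; rewrite sS /=.
  exact: card_centralizer_noncentral.
have leM : p%:R * #|D|%:R <= M%:R :> rat.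
  rewrite -natrM ler_nat mulnC -sum_nat_const.
  by apply: leq_sum => s /boundD[].
have geM : p%:R * M%:R <= #|D|%:R * #|R|%:R :> rat.
  rewrite -!natrM ler_nat /M big_distrr -sum_nat_const.
  by apply: leq_sum => s /boundD[].
have cardS : #|S|%:R = #|rel_center S|%:R + #|D|%:R :> rat.
  rewrite -natrD -(cardsID (rel_center S) S) (setIidPr _) //.
  by apply/subsetP=> s; rewrite in_rel_center => /andP[].
have S_neq0 := lt0r_neq0 S_gt0; have R_neq0 := lt0r_neq0 R_gt0.
have p_neq0 := lt0r_neq0 p_gt0.
have SR_gt0 := mulr_gt0 S_gt0 R_gt0.
rewrite natrD natrM; split.
  rewrite ler_pdivlMr // mulrDl divfK ?mulf_neq0 // mulrA divfK //.
  by rewrite mulrC lerD ?(mulrC #|R|%:R) // cardS addrC addKr.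
rewrite ler_pdivrMr // mulrAC ler_pdivlMr ?mulr_gt0 //.
have -> : ((p%:R - 1) * #|rel_center S|%:R + #|S|%:R) * (#|S|%:R * #|R|%:R)
  = #|S|%:R * (p%:R * #|rel_center S|%:R * #|R|%:R + #|D|%:R * #|R|%:R) :> rat.
  by rewrite cardS; ring.
rewrite mulrA [X in X * _]mulrC [X in X <= _]mulrC ler_pM2l //.
by rewrite mulrDr mulrA lerD2l.
Qed.
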